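(* No Type A configuration of $G'$ is eternally winning. In fact, when the guards form a Type A configuration of $G'$, an attack on the edge $c_1u_0$ has no legal response.
   Context: The graph $G$ has 32 vertices, $V=A\cup C\cup P\cup Q\cup R\cup Z\cup U$ (disjoint union), where $A=\{a_1,a_2,a_3\}$, $C=\{c_1,c_2,c_3\}$, $Q=\{q_1,q_2,q_3\}$, $R=\{r_1,r_2,r_3\}$, $Z=\{z_0,z_{12},z_{23},z_{13}\}$, $U=\{u_0,u_{12},u_{23},u_{13}\}$, and $P$ consists of 12 private vertices, two for each of the six support vertices (the vertices of $A\cup C$). Its edges are exactly: each support vertex is adjacent to its own two private vertices (its private neighbors), and these two are adjacent to each other; for each $i\in\{1,2,3\}$ both $a_i$ and $c_i$ are adjacent to both $q_i$ and $r_i$; for $1\le i<j\le 3$, $z_{ij}$ is adjacent to $a_i,a_j,q_i,q_j$ and $u_{ij}$ is adjacent to $c_i,c_j,r_i,r_j$; $z_0$ is adjacent to $q_1,q_2,a_1$; $u_0$ is adjacent to $r_1,r_2,c_1$. The graph $G'$ is obtained from $G$ by deleting the single edge $q_1z_{13}$. A Type A configuration is a set consisting of $A\cup C\cup R\cup Z$ together with exactly one private neighbor of each support vertex (19 vertices), with one guard on each of its vertices. A connected vertex cover of a graph is a set of vertices that meets every edge and induces a connected subgraph. Eternal Connected Vertex Cover game: guards occupy distinct vertices forming a connected vertex cover. In each round the attacker attacks an edge. The defender responds by moving guards simultaneously: each guard stays put or moves to a neighbouring vertex, at least one guard must move across the attacked edge (from one endpoint to the other; guards on both endpoints may exchange positions),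 and after the movement at most one guard occupies each vertex. A response is legal if the set of occupied vertices afterwards is again a connected vertex cover; otherwise (or if no legal response exists) the attacker wins. A configuration is eternally winning if, starting from it, the defender can defend every infinite sequence of attacks. *)

(* Defs.v *)
From HB Require Import structures.
From mathcomp Require Import all_boot.
Set Implicit Arguments.
Unset Strict Implicit.
Unset Printing Implicit Defensive.

Section Game.

Variables (T : finType) (e : rel T).

Definition del_edge (u v : T) : rel T :=
  [rel x y | e x y && ~~ ((x == u) && (y == v) || (x == v) && (y == u))].

Definition vertex_cover (S : {set T}) : Prop :=
  forall x y, e x y -> (x \in S) || (y \in S).

Definition induced (S : {set T}) : rel T :=
  [rel x y | [&& x \in S, y \in S & e x y]].

Definition connected_set (S : {set T}) : Prop :=
  {in S &, forall x y, connect (induced S) x y}.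

Definition connected_vertex_cover (S : {set T}) : Prop :=
  vertex_cover S /\ connected_set S.

(* An edge is attacked as an ordered pair of endpoints; the order is
   irrelevant to the conditions on the response. *)
Definition attack : Type := (T * T)%type.

(* The guard standing on x \in S goes to f x; the values of f outside S play
   no role.  Injectivity allows two guards to exchange their positions. *)
Definition legal_response (S : {set T}) (uv : attack) (f : T -> T) : Prop :=
  [/\ {in S, forall x, f x = x \/ e x (f x)},
      {in S &, injective f},
      (uv.1 \in S /\ f uv.1 = uv.2) \/ (uv.2 \in S /\ f uv.2 = uv.1)
    & connected_vertex_cover (f @: S)].

(* The defender sees the attacks up to and including the current one, and
   nothing of the later ones. *)
Definition strategy : Type := seq attack -> T -> T.

Fixpoint play (sigma : strategy) (att : nat -> attack) (S : {set T})
    (n : nat) : {set T} :=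
  if n is m.+1 then sigma (mkseq att m.+1) @: play sigma att S m else S.

Definition eternally_winning (S : {set T}) : Prop :=
  connected_vertex_cover S /\
  exists sigma : strategy, forall att : nat -> attack,
    (forall n, e (att n).1 (att n).2) ->
    forall n, legal_response (play sigma att S n) (att n)
                             (sigma (mkseq att n.+1)).

End Game.

Inductive idx := I1 | I2 | I3.

Definition encode_idx (i : idx) : option bool :=
  match i with I1 => None | I2 => Some false | I3 => Some true end.
Definition decode_idx (k : option bool) : idx :=
  match k with None => I1 | Some false => I2 | Some true => I3 end.
Lemma encode_idxK : cancel encode_idx decode_idx.
Proof. by case. Qed.
HB.instance Definition _ := Finite.copy idx (can_type encode_idxK).

Inductive label := L0 | L12 | L23 | L13.

Definition encode_label (l : label) : option idx :=
  match l with L0 => None | L12 => Some I1 | L23 => Some I2 | L13 => Some I3 end.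
Definition decode_label (k : option idx) : label :=
  match k with None => L0 | Some I1 => L12 | Some I2 => L23 | Some I3 => L13 end.
Lemma encode_labelK : cancel encode_label decode_label.
Proof. by case. Qed.
HB.instance Definition _ := Finite.copy label (can_type encode_labelK).

(* inl i stands for a_i and inr i for c_i. *)
Definition support_index : finType := (idx + idx)%type.

Definition index_of (s : support_index) : idx :=
  match s with inl i | inr i => i end.

Inductive vertex :=
  | Supp of support_index
  | Priv of support_index & bool
  | Q of idx
  | R of idx
  | Z of label
  | U of label.

Definition c (i : idx) : vertex := Supp (inr i).

Definition vertex_code : finType :=
  (support_index + support_index * bool + (idx + idx) + (label + label))%type.
Definition encode (v : vertex) : vertex_code :=
  match v with
  | Supp s => inl (inl (inl s))
  | Priv s b => inl (inl (inr (s, b)))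
  | Q i => inl (inr (inl i))
  | R i => inl (inr (inr i))
  | Z l => inr (inl l)
  | U l => inr (inr l)
  end.
Definition decode (k : vertex_code) : vertex :=
  match k with
  | inl (inl (inl s)) => Supp s
  | inl (inl (inr (s, b))) => Priv s b
  | inl (inr (inl i)) => Q i
  | inl (inr (inr i)) => R i
  | inr (inl l) => Z l
  | inr (inr l) => U l
  end.
Lemma encodeK : cancel encode decode.
Proof. by case. Qed.
HB.instance Definition _ := Finite.copy vertex (can_type encodeK).

(* The i such that z_l is adjacent to a_i (and u_l to c_i). *)
Definition support_nbrs (l : label) : seq idx :=
  match l with
  | L0 => [:: I1]
  | L12 => [:: I1; I2]
  | L23 => [:: I2; I3]
  | L13 => [:: I1; I3]
  end.

(* The i such that z_l is adjacent to q_i (and u_l to r_i). *)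
Definition middle_nbrs (l : label) : seq idx :=
  match l with
  | L0 => [:: I1; I2]
  | L12 => [:: I1; I2]
  | L23 => [:: I2; I3]
  | L13 => [:: I1; I3]
  end.

Definition arc (x y : vertex) : bool :=
  match x, y with
  | Supp s, Priv t _ => s == t
  | Priv s b, Priv t b' => (s == t) && (b != b')
  | Supp s, Q i => index_of s == i
  | Supp s, R i => index_of s == i
  | Z l, Supp (inl i) => i \in support_nbrs l
  | Z l, Q i => i \in middle_nbrs l
  | U l, Supp (inr i) => i \in support_nbrs l
  | U l, R i => i \in middle_nbrs l
  | _, _ => false
  end.

Definition G : rel vertex := [rel x y | arc x y || arc y x].

Definition G' : rel vertex := del_edge G (Q I1) (Z L13).

(* p s selects the private neighbour of s that carries a guard. *)
Definition typeA (S : {set vertex}) : Prop :=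
  exists p : support_index -> bool,
    S = [set Supp s | s : support_index] :|: [set R i | i : idx]
        :|: [set Z l | l : label] :|: [set Priv s (p s) | s : support_index].

(* Main.v *)
Require Import Defs.
From mathcomp Require Import all_boot zify.

(** The proof counts guards, twice.

    A vertex cover occupies at least two vertices of each of the six triangles
    formed by a support vertex and its private vertices, so 19 guards leave at
    most seven for Q, Z, R and U.  The edges between Q and Z require three
    guards in Q and Z, and three suffice only when they fill Q and leave Z
    empty ([QZ_cover]).  Once u_0 is occupied, as it is after any response to
    the attack on c_1 u_0, the other three vertices of U and those of R span a
    6-cycle, which requires three more guards, and three suffice only when they
    fill R or fill the rest of U ([RU_cover]).  As 3 + 4 = 7, both bounds are
    attained.  If the 6-cycle is covered by R, then no vertex of Z and none of
    u_12, u_23, u_13 is occupied, so nothing joins the index 3 to the indices 1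
    and 2 and the cover is disconnected.  Hence a connected cover of at most 19
    vertices that contains u_0 contains the whole of U
    ([small_cover_contains_U]).

    Then U and the triangles of c_1, c_2, c_3 hold at least 4 + 6 = 10 guards.
    In one move, a guard of a Type A configuration reaches these vertices only
    from R or from the triangles of C, where there are only 3 + 6 = 9 guards. *)

Definition triangle (s : support_index) : seq vertex :=
  [:: Supp s; Priv s false; Priv s true].

Definition indices : seq idx := [:: I1; I2; I3].
Definition supports : seq support_index := map inl indices ++ map inr indices.
Definition labels : seq label := [:: L0; L12; L23; L13].

Definition QZ : seq vertex := map Q indices ++ map Z labels.
Definition RU : seq vertex := map R indices ++ map U labels.

Lemma triangle_cover (X : {set vertex}) (s : support_index) :
  vertex_cover G' X -> 2 <= count (mem X) (triangle s).
Proof.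
move=> cov.
have /cov : G' (Supp s) (Priv s false) by case: s => [] [].
have /cov : G' (Supp s) (Priv s true) by case: s => [] [].
have /cov : G' (Priv s false) (Priv s true) by case: s => [] [].
by rewrite /=; do 3!case: (_ \in X).
Qed.

Lemma triangles_cover (X : {set vertex}) (ss : seq support_index) :
  vertex_cover G' X ->
  2 * size ss <= count (mem X) (flatten (map triangle ss)).
Proof.
move=> cov; elim: ss => // s ss IH.
rewrite -cat1s map_cat flatten_cat count_cat mulnS leq_add //.
exact: triangle_cover.
Qed.

(** The edges z_0 q_1, z_12 q_2, z_23 q_3 form a matching, which gives the
    bound 3.  In case of equality, q_2 is occupied, since otherwise z_0, z_12,
    z_23 are and z_13 q_3 needs a fourth vertex; then q_1 is, since otherwise
    z_0 and z_12 are and z_23 q_3 needs a fourth; finally only q_3 covers both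
    z_23 q_3 and z_13 q_3. *)
Lemma QZ_cover (X : {set vertex}) :
  vertex_cover G' X ->
  3 <= count (mem X) QZ
  /\ (count (mem X) QZ <= 3 ->
      (forall i, Q i \in X) /\ (forall l, Z l \notin X)).
Proof.
move=> cov.
have := cov (Z L0) (Q I1) isT; have := cov (Z L0) (Q I2) isT.
have := cov (Z L12) (Q I1) isT; have := cov (Z L12) (Q I2) isT.
have := cov (Z L23) (Q I2) isT; have := cov (Z L23) (Q I3) isT.
have := cov (Z L13) (Q I3) isT.
rewrite /QZ /=.
case q1: (Q I1 \in X); case q2: (Q I2 \in X); case q3: (Q I3 \in X);
case z0: (Z L0 \in X); case z12: (Z L12 \in X);
case z23: (Z L23 \in X); case z13: (Z L13 \in X) => //= *;
by split=> // _; split; case; rewrite ?q1 ?q2 ?q3 ?z0 ?z12 ?z23 ?z13.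
Qed.

(** The second part holds because the two colour classes are the only vertex
    covers of size 3 of the 6-cycle r_1 u_12 r_2 u_23 r_3 u_13. *)
Lemma RU_cover (X : {set vertex}) :
  vertex_cover G' X -> U L0 \in X ->
  4 <= count (mem X) RU
  /\ (count (mem X) RU <= 4 ->
      (forall l, U l \in X) \/ (forall l, l != L0 -> U l \notin X)).
Proof.
move=> cov u0.
have := cov (U L12) (R I1) isT; have := cov (U L12) (R I2) isT.
have := cov (U L23) (R I2) isT; have := cov (U L23) (R I3) isT.
have := cov (U L13) (R I1) isT; have := cov (U L13) (R I3) isT.
rewrite /RU /= u0.
case: (R I1 \in X); case: (R I2 \in X); case: (R I3 \in X);
case u12: (U L12 \in X); case u23: (U L23 \in X);
case u13: (U L13 \in X) => //= *; split=> // _;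
by [left; case | right; case=> //; rewrite ?u12 ?u23 ?u13].
Qed.

Definition at_index3 (v : vertex) : bool :=
  match v with
  | Supp s | Priv s _ => index_of s == I3
  | Q i | R i => i == I3
  | Z _ | U _ => false
  end.

(** Only vertices of Z and U have neighbours at two different indices, and u_0
    has none at the index 3. *)
Lemma index3_separated (X : {set vertex}) :
  (forall l, Z l \notin X) -> (forall l, l != L0 -> U l \notin X) ->
  Q I1 \in X -> Q I3 \in X -> ~ connected_set G' X.
Proof.
move=> noZ noU q1 q3 /(_ _ _ q1 q3) path13.
suff clos : closed (induced G' X) at_index3.
  by have := closed_connect clos path13.
move=> x y /and3P[xX yX /andP[adj _]].
have ZX l : Z l \in X -> False by apply/negP.
have UX l : U l \in X -> l = L0.
  by move=> uX; apply/eqP; apply: contraLR uX => /noU.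
rewrite -!topredE /=; move: adj.
case: x xX => [[[]|[]]|[[]|[]] ?|[]|[]|l|l] xX;
  try by case: (ZX _ xX).
all: try (have := UX _ xX => El; subst l).
all: case: y yX => [[[]|[]]|[[]|[]] ?|[]|[]|k|k] yX //=;
  try by case: (ZX _ yX).
all: by have := UX _ yX => ->.
Qed.

Definition all_vertices : seq vertex := flatten (map triangle supports) ++ QZ ++ RU.

Lemma small_cover_contains_U (X : {set vertex}) :
  connected_vertex_cover G' X -> U L0 \in X ->
  count (mem X) all_vertices <= 19 -> forall l, U l \in X.
Proof.
move=> [cov conn] u0.
rewrite /all_vertices (count_cat _ (flatten _)) (count_cat _ QZ) => le19.
have ge12 : 12 <= count (mem X) (flatten (map triangle supports)).
  exact: (triangles_cover X supports cov).
have [ge3 eq3] := QZ_cover _ cov.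
have [ge4 eq4] := RU_cover _ cov u0.
(* The counts become variables, so that arithmetic does not compute them. *)
move: (count _ _) (count _ QZ) (count _ RU) ge12 le19 ge3 eq3 ge4 eq4
  => nT nQZ nRU ge12 le19 ge3 eq3 ge4 eq4.
have [|QX noZ] := eq3; first by lia.
have [|//|noU] := eq4; first by lia.
by have := index3_separated _ noZ noU (QX I1) (QX I3) conn.
Qed.

Definition guards (p : support_index -> bool) : seq vertex :=
  map Supp supports ++ map R indices ++ map Z labels
  ++ [seq Priv s (p s) | s <- supports].

Lemma typeA_guards (S : {set vertex}) :
  typeA S -> exists p, {subset S <= guards p}.
Proof.
case=> p ->; exists p => x; rewrite !in_setU /guards !mem_cat.
have inI i : i \in indices by case: i.
have inL l : l \in labels by case: l.
have inS s : s \in supports by case: s => [] [].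
by case/orP=> [/orP[/orP[]|]|] /imsetP[y _ ->]; apply/or4P;
  [constructor 1 | constructor 2 | constructor 3 | constructor 4]; apply: map_f.
Qed.

Lemma count_imset_le {T : finType} (f : T -> T) (S : {set T}) (L gs : seq T) :
  uniq L -> {in S, forall x, f x \in L -> x \in gs} ->
  count (mem (f @: S)) L <= size gs.
Proof.
move=> uL from_gs; rewrite -size_filter -(size_map f gs).
apply: uniq_leq_size; first exact: filter_uniq.
move=> y; rewrite mem_filter => /andP[/imsetP[x xS ->] fxL].
by rewrite map_f // from_gs.
Qed.

Definition on_C_side (v : vertex) : bool :=
  match v with Supp (inr _) | Priv (inr _) _ | U _ => true | _ => false end.

Definition C_side : seq vertex :=
  flatten (map triangle (map inr indices)) ++ map U labels.

Definition in_R (v : vertex) : bool := if v is R _ then true else false.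

(** Outside R, only the vertices of Q have neighbours on the C side without
    lying there, and they carry no guard in a Type A configuration. *)
Lemma C_side_reached (p : support_index -> bool) (x y : vertex) :
  x \in guards p -> y = x \/ G' x y -> on_C_side y -> on_C_side x || in_R x.
Proof.
(* Membership of a vertex of Q in the list of guards computes to false. *)
case: x => [[?|?]|[?|?] ?|?|?|?|?] //= _.
all: by case=> [->|/andP[+ _]] //; case: y => [[]|[]||||].
Qed.

Lemma no_response (S : {set vertex}) :
  typeA S -> ~ exists f, legal_response G' S (c I1, U L0) f.
Proof.
move=> /typeA_guards[p Sp] [f [moves _ attacked CVC]].
have u0 : U L0 \in f @: S.
  case: attacked => /= -[inS fE]; first by rewrite -fE imset_f.
  by move/Sp: inS.
have le19 : count (mem (f @: S)) all_vertices <= 19.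
  by apply: (@count_imset_le _ f S all_vertices (guards p)) => // x /Sp.
have UX := small_cover_contains_U _ CVC u0 le19.
have le9 : count (mem (f @: S)) C_side <= 9.
  pose sources := [seq x <- guards p | on_C_side x || in_R x].
  apply: (@count_imset_le _ f S C_side sources) => // x xS fxC.
  have xg := Sp x xS; rewrite mem_filter xg andbT.
  have C_sideP : all on_C_side C_side by [].
  exact: C_side_reached xg (moves x xS) (allP C_sideP _ fxC).
have ge10 : 10 <= count (mem (f @: S)) C_side.
  rewrite /C_side count_cat; apply: (@leq_add 6 4); last by rewrite /= !UX.
  exact: (triangles_cover _ (map inr indices) CVC.1).
by have := leq_trans ge10 le9.
Qed.

Theorem lemma14 :
  (forall S : {set vertex}, typeA S -> ~ eternally_winning G' S) /\
  (forall S : {set vertex}, typeA S ->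
     G' (c I1) (U L0) /\
     ~ exists f : vertex -> vertex, legal_response G' S (c I1, U L0) f).
Proof.
split=> S SA; last by split=> //; apply: no_response.
case=> _ [sigma win]; apply: (no_response S SA).
have := win (fun=> (c I1, U L0)) (fun=> isT) 0.
by exists (sigma [:: (c I1, U L0)]).
Qed.
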